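(* Let $m$ and $n$ be integers with $2\le m\le n$. Then $L(m,n)\ge n-m+1$.
   Context: Let $m,n$ be integers with $2\le m\le n$. An $m$ by $n$ array consists of $mn$ cells arranged in $m$ rows and $n$ columns, each cell containing exactly one symbol (symbols are arbitrary and may repeat). A transversal of an array consists of $m$ cells, one from each row and no two from the same column. A latin transversal is a transversal in which no symbol appears more than once. $L(m,n)$ denotes the largest integer such that every $m$ by $n$ array in which each symbol appears at most $L(m,n)$ times has a latin transversal. *)

(* Defs.v *)
From mathcomp Require Import all_boot all_algebra.
From mathcomp Require Import boolp classical_sets.

Set Implicit Arguments.
Unset Strict Implicit.
Unset Printing Implicit Defensive.

(* A cell is a pair (row, column); a set of cells is a {set 'I_m * 'I_n}. *)
Definition transversal (m n : nat) (S : {set 'I_m * 'I_n}) : Prop :=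
  [/\ #|S| = m,
      forall i : 'I_m, #|[set c in S | c.1 == i]| = 1 &
      {in S &, injective (fun c => c.2)}].

Definition latin_transversal (T : eqType) (m n : nat) (A : 'M[T]_(m, n))
    (S : {set 'I_m * 'I_n}) : Prop :=
  transversal S /\ {in S &, injective (fun c => A c.1 c.2)}.

Definition occurrences (T : eqType) (m n : nat) (A : 'M[T]_(m, n)) (x : T) :
    nat :=
  #|[set c : 'I_m * 'I_n | A c.1 c.2 == x]|.

Definition forces_latin (m n k : nat) : Prop :=
  forall (T : eqType) (A : 'M[T]_(m, n)),
    (forall x : T, occurrences A x <= k) ->
    exists S : {set 'I_m * 'I_n}, latin_transversal A S.

Definition largest (P : nat -> Prop) (k : nat) : Prop :=
  P k /\ forall j : nat, P j -> j <= k.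

(* The largest k with forces_latin m n k. It exists whenever 2 <= m <= n
   (see L_largest below), so the default value 0 is then never used. *)
Definition L (m n : nat) : nat :=
  xget 0 [set k | largest (forces_latin m n) k]%classic.

Lemma forces_latin0 (m n : nat) : 0 < m -> 0 < n -> forces_latin m n 0.
Proof.
case: m => // m _; case: n => // n _ T A /(_ (A ord0 ord0)).
rewrite leqn0 cards_eq0 => /eqP /setP /(_ (ord0, ord0)).
by rewrite !inE eqxx.
Qed.

Lemma forces_latin_bound (m n k : nat) :
  1 < m -> forces_latin m n k -> k < m * n.
Proof.
move=> m_gt1 Pk; rewrite ltnNge; apply/negP => le_mn_k.
have [x|S [[cardS _ _] injS]] := Pk unit (const_mx tt).
  by apply: leq_trans le_mn_k; rewrite (leq_trans (max_card _)) // card_prod !card_ord.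
have/card_gt1P[a [b [aS bS]]] : 1 < #|S| by rewrite cardS.
by rewrite (injS a b aS bS) ?eqxx //; case: (_ a.1 a.2) (_ b.1 b.2) => [] [].
Qed.

Lemma L_largest (m n : nat) :
  2 <= m -> m <= n -> largest (forces_latin m n) (L m n).
Proof.
move=> m_gt1 le_mn; apply: (@xgetPex _ 0 [set k | largest _ k]%classic).
have m_gt0 : 0 < m by apply: ltnW.
have exP : exists k, `[< forces_latin m n k >].
  by exists 0; apply/asboolP/forces_latin0 => //; apply: leq_trans le_mn.
have ubP k : `[< forces_latin m n k >] -> k <= m * n.
  by move=> /asboolP /(forces_latin_bound m_gt1) /ltnW.
exists (ex_maxn exP ubP); case: ex_maxnP => k /asboolP Pk max_k.
by split=> // j /asboolP; apply: max_k.
Qed.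

(* Main.v *)
Require Import Defs.
From mathcomp Require Import all_boot.
From mathcomp Require Import boolp matrix.

(** Let k = n - m + 1. It suffices that an array in which each symbol occurs at
    most k times has a latin transversal, which is proved by covering the rows
    one at a time ([latin_choice_exists]).

    Suppose that all rows of D except r0 are covered by cells with distinct
    columns and distinct symbols. At least k columns are free. If some free
    cell of the uncovered row carries a new symbol, it can be added. Otherwise
    each free cell of the uncovered row r repeats the symbol of a covered row i,
    and using it evicts row i: now i is the uncovered row, the columns and
    symbols in use are still distinct, and the set of symbols in use has not
    changed. Let R be the set of all rows that can become uncovered through such
    exchanges ([reachable]).

    The rows of R other than the uncovered one always use the same |R| - 1
    symbols ([reachable_symbol]), and each row of R has, at the moment when it is
    uncovered, at least k free cells, all with one of these symbols, since the
    evicted row is again in R. This gives at least |R| k cells carrying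
    only |R| - 1 symbols, although each symbol occurs at most k times: a
    contradiction ([extend_latin_choice]). *)

Set Implicit Arguments.
Unset Strict Implicit.
Unset Printing Implicit Defensive.

(** A partial latin transversal covering the rows in [D]: row [i] of [D] uses
    the cell [(i, f i)]. The values of [f] outside [D] are irrelevant. *)
Definition latin_choice (T : eqType) (m n : nat) (A : 'M[T]_(m, n))
    (D : {set 'I_m}) (f : 'I_m -> 'I_n) : Prop :=
  {in D &, injective f} /\ {in D &, injective (fun i => A i (f i))}.

(** [reachable A D r0 f0 r f]: exchanges lead from the choice [f0] covering
    [D :\ r0] to the choice [f] covering [D :\ r]. One exchange covers the
    uncovered row [r] by a cell in a free column [j] and uncovers the row [i]
    that was using the symbol of this cell. *)
Inductive reachable (T : eqType) (m n : nat) (A : 'M[T]_(m, n))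
    (D : {set 'I_m}) (r0 : 'I_m) (f0 : 'I_m -> 'I_n) :
    'I_m -> ('I_m -> 'I_n) -> Prop :=
| reachable_refl : reachable A D r0 f0 r0 f0
| reachable_step r f i j : reachable A D r0 f0 r f ->
    j \notin f @: (D :\ r) -> i \in D :\ r -> A r j = A i (f i) ->
    reachable A D r0 f0 i (fun x => if x == r then j else f x).

Lemma card_bigcup_le (I T : finType) (P : pred I) (F : I -> {set T}) k :
  (forall i, P i -> #|F i| <= k) -> #|\bigcup_(i | P i) F i| <= #|P| * k.
Proof.
move=> leF; rewrite -sum_nat_const.
apply: (big_ind2 (fun (X : {set T}) s => #|X| <= s)) => [|X s Y t leX leY|//].
  by rewrite cards0.
by apply: leq_trans (leq_add leX leY); rewrite cardsU leq_subr.
Qed.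

Lemma card_rows_le (I J : finType) (R : {set I}) (C : {set I * J}) k :
  {in R, forall i, k <= #|[set j | (i, j) \in C]|} -> #|R| * k <= #|C|.
Proof.
move=> leC; rewrite -sum_nat_const.
have -> : #|C| = \sum_i #|[set j | (i, j) \in C]|.
  rewrite -sum1_card (eq_bigr (fun i => \sum_(j | (i, j) \in C) 1)).
    by rewrite pair_big_dep; apply: eq_bigl => -[].
  by move=> i _; rewrite -sum1_card; apply: eq_bigl => j; rewrite inE.
rewrite [X in _ <= X](bigID (mem R)) /=.
by apply: leq_trans (leq_addr _ _); apply: leq_sum.
Qed.

Lemma latin_choice_setU1 (T : eqType) (m n : nat) (A : 'M[T]_(m, n))
    (X : {set 'I_m}) (f : 'I_m -> 'I_n) (r : 'I_m) (j : 'I_n) :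
    latin_choice A X f -> r \notin X -> j \notin f @: X ->
    (forall i, i \in X -> A r j <> A i (f i)) ->
  latin_choice A (r |: X) (fun x => if x == r then j else f x).
Proof.
move=> [injf injA] rX jfree new.
have fj x : x \in X -> f x <> j.
  by move=> Xx E; case/negP: jfree; rewrite -E; apply: imset_f.
split=> x y; rewrite !inE /=;
  have [->|_] := eqVneq x r; have [->|_] := eqVneq y r => //= Xx Xy.
- by move=> /esym /(fj _ Xy).
- by move=> /(fj _ Xx).
- exact: injf.
- by move=> /(new _ Xy).
- by move=> /esym /(new _ Xx).
- exact: injA.
Qed.

Section Exchange.
Variables (T : eqType) (m n : nat) (A : 'M[T]_(m, n)).
Variables (D : {set 'I_m}) (r0 : 'I_m) (f0 : 'I_m -> 'I_n).
Hypothesis Dr0 : r0 \in D.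
Hypothesis latin_f0 : latin_choice A (D :\ r0) f0.

(** The rows that some sequence of exchanges leaves uncovered. *)
Let R := [set r | `[< exists f, reachable A D r0 f0 r f >]].

Let reachableR r f : reachable A D r0 f0 r f -> r \in R.
Proof. by move=> rf; rewrite inE; apply/asboolP; exists f. Qed.

Lemma reachable_latin r f : reachable A D r0 f0 r f ->
  r \in D /\ latin_choice A (D :\ r) f.
Proof.
elim=> {r f} [//|r f i j _ [Dr latin_f] jfree Dri Arj].
have [ir Di] : i != r /\ i \in D by apply/andP; rewrite -in_setD1.
have sub : D :\ r :\ i \subset D :\ r by apply: subsetDl.
have -> : D :\ i = r |: (D :\ r :\ i).
  apply/setP => x; rewrite !inE; have [->|//] := eqVneq x r.
  by rewrite eq_sym ir Dr.
split=> //; apply: latin_choice_setU1.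
- case: latin_f => injf injA.
  by split=> x y /(subsetP sub) Dx /(subsetP sub) Dy; [apply: injf|apply: injA].
- by rewrite !inE eqxx andbF.
- by apply: contra jfree => /imsetP[x /(subsetP sub) Dx ->]; apply: imset_f.
- move=> x; rewrite in_setD1 => /andP[xi Dx]; rewrite Arj => /latin_f.2 E.
  by rewrite E ?eqxx in xi.
Qed.

(** Exchanges bring no new symbol to the covered rows of [R]: in each one, the
    newly covered row takes over the symbol of the evicted one. *)
Lemma reachable_symbol r f : reachable A D r0 f0 r f ->
  {in R :\ r, forall x, exists2 y, y \in R :\ r0 & A x (f x) = A y (f0 y)}.
Proof.
elim=> {r f} [x Rx|r f i j rf IH jfree Dri Arj x].
  by exists x.
rewrite !inE => /andP[xi Rx]; have [->|xr] := eqVneq x r; last first.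
  by apply: IH; rewrite !inE xr.
rewrite Arj; apply: IH.
rewrite in_setD1 (reachableR (reachable_step rf jfree Dri Arj)) andbT.
by move: Dri; rewrite !inE => /andP[].
Qed.

Lemma extend_latin_choice :
    m <= n -> (forall x, occurrences A x <= n - m + 1) ->
  exists f, latin_choice A D f.
Proof.
move=> le_mn occ; apply: contrapT => noext.
pose C := \bigcup_(y in R :\ r0) [set c : 'I_m * 'I_n | A c.1 c.2 == A y (f0 y)].
have Rr0 : r0 \in R by apply: reachableR; apply: reachable_refl.
have ubC : #|C| <= #|R :\ r0| * (n - m + 1).
  by apply: card_bigcup_le => y _; apply: occ.
have lbC : #|R| * (n - m + 1) <= #|C|.
  apply: card_rows_le => r; rewrite inE => /asboolP[f rf].
  have [Dr latin_f] := reachable_latin rf.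
  (* At most |D| - 1 <= m - 1 columns are in use, so at least
     n - m + 1 are free. *)
  have le_free : n - m + 1 <= #|~: (f @: (D :\ r))|.
    rewrite cardsCs setCK card_ord.
    have := leq_imset_card f (D :\ r); have := max_card (mem D).
    rewrite card_ord (cardsD1 r D) Dr add1n => leD leI.
    have lt_im := leq_ltn_trans leI leD.
    by rewrite addn1 ltn_sub2l // (leq_trans lt_im).
  apply: leq_trans le_free _; apply: subset_leq_card; apply/subsetP => j.
  rewrite !inE => jfree.
  have [i Dri Arj] : exists2 i, i \in D :\ r & A r j = A i (f i).
    apply: contrapT => new; apply: noext.
    exists (fun x => if x == r then j else f x).
    rewrite -(setD1K Dr); apply: latin_choice_setU1 => //.
      by rewrite !inE eqxx.
    by move=> i Dri Arj; apply: new; exists i.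
  have Ri : i \in R :\ r.
    rewrite in_setD1 (reachableR (reachable_step rf jfree Dri Arj)) andbT.
    by move: Dri; rewrite !inE => /andP[].
  have [y Ry Ay] := reachable_symbol rf Ri.
  by apply/bigcupP; exists y; rewrite // inE /= Arj Ay.
have := leq_trans lbC ubC.
by rewrite (cardsD1 r0 R) Rr0 leq_pmul2r ?addn1 // add1n ltnn.
Qed.

End Exchange.

Lemma latin_choice_exists (T : eqType) (m n : nat) (A : 'M[T]_(m, n))
    (D : {set 'I_m}) :
    0 < m -> m <= n -> (forall x, occurrences A x <= n - m + 1) ->
  exists f, latin_choice A D f.
Proof.
move=> m_gt0 le_mn occ; have [d] := ubnP #|D|; elim: d D => // d IH D.
have [->|[r Dr]] := set_0Vmem D.
  by exists (fun=> Ordinal (leq_trans m_gt0 le_mn)); split=> x y; rewrite inE.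
rewrite (cardsD1 r D) Dr add1n ltnS => /IH[f latin_f].
exact: extend_latin_choice Dr latin_f le_mn occ.
Qed.

Lemma latin_choice_transversal (T : eqType) (m n : nat) (A : 'M[T]_(m, n))
    (f : 'I_m -> 'I_n) :
  latin_choice A [set: 'I_m] f ->
  latin_transversal A [set (i, f i) | i : 'I_m].
Proof.
move=> [injf injA]; split; first split.
- by rewrite card_imset ?card_ord // => x y [].
- move=> i; rewrite -(cards1 (i, f i)); apply: eq_card => -[a b]; rewrite !inE /=.
  apply/andP/eqP => [[/imsetP[x _ [-> ->]] /eqP -> //]|[-> ->]].
  by split=> //; apply/imsetP; exists i.
- by move=> _ _ /imsetP[x _ ->] /imsetP[y _ ->] /= /injf ->.
- by move=> _ _ /imsetP[x _ ->] /imsetP[y _ ->] /= /injA ->.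
Qed.

Theorem theorem4 (m n : nat) (hm : 2 <= m) (hmn : m <= n) :
  n - m + 1 <= L m n.
Proof.
have [_ maxL] := L_largest hm hmn; apply: maxL => T A occ.
have [f latin_f] := latin_choice_exists [set: 'I_m] (ltnW hm) hmn occ.
by exists [set (i, f i) | i : 'I_m]; apply: latin_choice_transversal.
Qed.
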